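(* Let $G$ be a finite non-cyclic group. If $$\frac{\mathfrak{md}_{\mathbb{Q}}(G)}{\#G}>\frac34,$$ then $G$ is solvable.
   Context: All $G$-sets are finite left $G$-sets. For a commutative ring $k$ and a $G$-set $X$, $k[X]$ denotes the permutation module of maps $X\to k$, a module over the group algebra $kG$. Two $G$-sets $X,Y$ are linearly equivalent over $k$ if $k[X]\cong k[Y]$ as $kG$-modules. $\mathfrak{md}_k(G)$ is the smallest integer $n$ such that there exist non-isomorphic $G$-sets $X,Y$ with $\#X=\#Y=n$ that are linearly equivalent over $k$; if no such pair exists, $\mathfrak{md}_k(G)=\infty$. *)

(* Defs.v *)
From HB Require Import structures.
From mathcomp Require Import all_boot all_order all_fingroup all_solvable all_algebra.
From mathcomp Require Import boolp constructive_ereal.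

Set Implicit Arguments.
Unset Strict Implicit.
Unset Printing Implicit Defensive.

Import GRing.Theory Num.Theory.

(* MathComp actions are right actions: [action G T] has [to x (g * h) =
   to (to x g) h] for g, h in G, and [to x a] carries no information on the
   G-set for a outside G. Left G-sets are encoded by them through
   g . x := to x g^-1, and everything below is phrased with this left action;
   conversely a left action of G comes from to x g := g^-1 . x
   (and to x g := x for g outside G). *)
Record gset (gT : finGroupType) (G : {group gT}) := GSet {
  gset_sort :> finType;
  gset_action : action G gset_sort
}.

Definition lact (gT : finGroupType) (G : {group gT}) (X : gset G)
    (g : gT) (x : X) : X :=
  gset_action X x (g^-1)%g.

Definition gset_iso (gT : finGroupType) (G : {group gT}) (X Y : gset G) : Prop :=
  exists phi : X -> Y,
    bijective phi /\ forall g x, g \in G -> phi (lact g x) = lact g (phi x).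

Local Open Scope ring_scope.

(* k[X] is the k-module {ffun X -> k^o} with G acting linearly on the left by
   (g . f)(x) = f(g^-1 . x). *)
Definition perm_module_act (k : comPzRingType) (gT : finGroupType)
    (G : {group gT}) (X : gset G) (g : gT) (f : {ffun X -> k^o}) : {ffun X -> k^o} :=
  [ffun x => f (lact (g^-1)%g x)].

(* A kG-module is a k-module with a k-linear action of G, and a kG-linear map
   is a k-linear map commuting with G. *)
Definition linearly_equivalent (k : comPzRingType) (gT : finGroupType)
    (G : {group gT}) (X Y : gset G) : Prop :=
  exists phi : {linear {ffun X -> k^o} -> {ffun Y -> k^o}},
    bijective phi /\
    forall g f, g \in G -> phi (perm_module_act g f) = perm_module_act g (phi f).

Definition md_witness (k : comPzRingType) (gT : finGroupType) (G : {group gT})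
    (n : nat) : Prop :=
  exists X Y : gset G,
    [/\ #|X| = n, #|Y| = n, ~ gset_iso X Y & linearly_equivalent k X Y].

Definition md (k : comPzRingType) (gT : finGroupType) (G : {group gT}) : \bar rat :=
  if pselect (exists n, `[< md_witness k G n >]) is left exn
  then (ex_minn exn)%:R%:E else +oo%E.

(* Main.v *)
From HB Require Import structures.
Require Import Defs.
From mathcomp Require Import all_boot all_order all_fingroup all_solvable all_algebra.
From mathcomp Require Import boolp constructive_ereal.
From mathcomp Require Import zify lra.

Set Implicit Arguments.
Unset Strict Implicit.
Unset Printing Implicit Defensive.

Import Order.TTheory GRing.Theory Num.Theory.

(* If every prime-power-order element acts trivially on every p-subgroup it
   normalises whenever its prime exceeds p, then, for p the least prime divisor
   of #|G|, a Sylow p-subgroup controls its own fusion, so transfer gives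
   G' < G, and by induction G is solvable. Hence a nonsolvable G contains a
   p-subgroup P and a q-element x, p < q, with x acting nontrivially on P; for P
   minimal and N maximal among the proper P<x>-invariant subgroups of P, the
   quotient V = P/N is elementary abelian and irreducible, and has no invariant
   hyperplane. Put L = N<x> and H = P<x>, which acts affinely on V = L\H.

   The H-sets (points of V) + (hyperplane directions) and
   (affine hyperplanes) + (one point) are linearly equivalent over Q by a Radon
   transform, and not isomorphic since only the second has an H-fixed point.
   Inducing to G preserves both facts. A direction has at least two hyperplanes,
   so there are at most #|G : L| directions in the induced set, whose size is
   thus at most 2 #|G : L| <= 2/3 #|G|. *)

(** * Coprime action in nonsolvable groups *)

Section Fusion.
Local Open Scope group_scope.
Variable gT : finGroupType.
Implicit Types (G P Q S T X : {group gT}) (p q : nat).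

(** By fusion control, the transfer from [G] to the abelianisation of [P] sends [z] in [P] to its
    class to the power [#|G : P|], an exponent prime to [p]. A perfect [G] has trivial transfer,
    which would put all of [P] in its derived subgroup. *)
Lemma Sylow_fusion_der1_proper p G P :
    p.-Sylow(G) P -> P :!=: 1 ->
    (forall x g, x \in P -> g \in G -> x ^ g \in P ->
       exists2 u, u \in P & x ^ g = x ^ u) ->
  G^`(1) \proper G.
Proof.
move=> sylP ntP fusP; have [sPG pP _] := and3P sylP.
rewrite properEneq der_sub andbT; apply/eqP => eqG'.
have /properP[_ [z Pz P'z]] : P^`(1) \proper P.
  exact: sol_der1_proper (pgroup_sol pP) (subxx _) ntP.
have nP'P : P \subset 'N(P^`(1)) := der_norm 1 P.
pose al := restrm_morphism nP'P (coset_morphism P^`(1)).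
have abP : abelian (al @* P).
  by rewrite /= morphim_restrm setIid; apply: der_abelian.
pose V := transfer_morphism G abP.
have Gz : z \in G := subsetP sPG z Pz.
have alP y : y \in P -> al y \in al @* P by move=> Py; apply: mem_morphim.
have alJ y u : y \in P -> u \in P -> al (y ^ u) = al y.
  move=> Py Pu; rewrite morphJ //.
  by apply: (conjg_fixP _); apply/commgP; apply: (centsP abP); apply: alP.
have Vz : V z = (FiniteModule.fmod abP (al z) *+ #|G : P|)%R.
  have trX := transversalP (rcosets_cycle_partition sPG Gz).
  rewrite /V /= (transfer_cycle_expansion sPG abP Gz trX).
  rewrite -(sum_index_rcosets_cycle sPG Gz trX) -sumrMnr.
  apply: eq_bigr => x Xx /=.
  have Gx : x \in G by rewrite (subsetP (transversal_sub trX)).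
  (* [n] is the length of the cycle of [z] on the coset of [x]. The transfer factor, [z ^+ n]
     conjugated by [x^-1], is fused to [z ^+ n] within [P]; the cycle lengths add up to
     [#|G : P|]. *)
  set n := #|_ : _|; have Pzn : z ^+ n \in P by rewrite groupX.
  have Pznx : (z ^+ n) ^ x^-1 \in P.
    rewrite conjgE invgK mulgA -mem_rcoset; exact: mulg_exp_card_rcosets.
  rewrite -FiniteModule.fmodX ?alP // -morphX //; congr (FiniteModule.fmod _ _).
  have [|u Pu ->] := fusP _ x^-1 Pzn _ Pznx; first by rewrite groupV.
  exact: alJ.
have V0 : V z = 0%R.
  have : z \in 'ker V.
    have : G^`(1) \subset 'ker V.
      rewrite gen_subG; apply/subsetP => _ /imset2P[a b Ga Gb ->].
      rewrite mem_morphpre ?groupR // morphR // inE; apply/commgP.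
      exact: (FinRing.zmod_mulgC).
    by rewrite eqG' => /subsetP->.
  by move/mker.
have : al z = 1.
  have co : coprime #|al @* P| #|G : P|.
    rewrite (coprime_dvdl (dvdn_morphim _ _)) // (pnat_coprime pP) //.
    by case/and3P: sylP.
  rewrite -(expgK co (alP z Pz)).
  have -> : al z ^+ #|G : P| = 1; last by rewrite expg1n.
  have := congr1 val (etrans (esym Vz) V0).
  by rewrite -FiniteModule.fmodX ?alP //= FiniteModule.fmodK ?groupX ?alP.
move=> /= /coset_idr; rewrite (subsetP nP'P) // => /(_ isT) P'z'.
by rewrite P'z' in P'z.
Qed.
Lemma Sylow_norm_cent_trans p G X S T :
    (forall x, x \in 'N_G(X) -> p^'.-elt x -> x \in 'C(X)) ->
    p.-Sylow('N_G(X)) S -> p.-Sylow('N_G(X)) T ->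
  exists2 c, c \in 'C_G(X) & T :=: S :^ c.
Proof.
move=> p'C sylS sylT.
have nCN : 'N_G(X) \subset 'N('C_G(X)).
  by rewrite normsI ?norms_cent ?subsetIr // subIset ?normG.
have pNC : p.-group ('N_G(X) / 'C_G(X)).
  apply/pgroupP => q q_pr /(Cauchy q_pr)[_ /morphimP[x nCx Nx ->] oxb].
  rewrite inE; apply: contraT => p'q.
  have p'x : p^'.-elt (coset 'C_G(X) x) by rewrite /p_elt oxb pnatE.
  have : (coset 'C_G(X) x).`_p^' = 1.
    rewrite -morph_constt //; apply: coset_id.
    have Nxp : x.`_p^' \in 'N_G(X) by rewrite groupX.
    by rewrite inE p'C ?p_elt_constt // andbT; case/setIP: Nxp.
  rewrite constt_p_elt // => x1; move: q_pr.
  by rewrite -oxb; move: x1 => /= ->; rewrite order1.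
have sSN := pHall_sub sylS.
have /(pHall_id (G := _)) /(_ pNC) eqSN := quotient_pHall (subset_trans sSN nCN) sylS.
have [n Nn ->] := Sylow_trans sylS sylT.
have /subsetP/(_ n Nn) : 'N_G(X) \subset 'C_G(X) * S.
  by rewrite -quotientSK // -eqSN.
rewrite -normC ?(subset_trans sSN) // => /mulsgP[s c Ss Cc ->].
by exists c; rewrite // conjsgM conjGid.
Qed.

(* Downward induction on [S :&: T]: a normaliser in a p-group grows. *)
Lemma Sylow_setI_cent_trans p G :
    (forall X x, X \subset G -> p.-group X -> x \in 'N_G(X) -> p^'.-elt x ->
       x \in 'C(X)) ->
  forall S T, p.-Sylow(G) S -> p.-Sylow(G) T ->
  exists2 c, c \in 'C_G(S :&: T) & T :=: S :^ c.
Proof.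
move=> p'C S T; have [n] := ubnP (#|G| - #|S :&: T|).
elim: n S T => // n IHn S T leGn sylS sylT.
have [sSG pS _] := and3P sylS; have [sTG pT _] := and3P sylT.
have eqST : #|S| = #|T| by rewrite (card_Hall sylS) (card_Hall sylT).
have [sST | prS] := boolP (S \subset T).
  exists 1; rewrite ?group1 // conjsg1.
  by apply/esym/eqP; rewrite eqEcard sST eqST leqnn.
set D := (S :&: T)%G; have sDG : D \subset G by rewrite subIset ?sSG.
have prDS : D \proper S by rewrite properE subsetIl subsetI subxx.
have prDT : D \proper T.
  by rewrite properEcard subsetIr -eqST proper_card.
have sylN (U : {group gT}) : p.-Sylow(G) U -> D \proper U ->
    {V : {group gT} | p.-Sylow('N_G(D)) V
       & D \subset V /\ forall W : {group gT}, V \subset W -> #|D| < #|U :&: W|}.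
  case/and3P=> sUG pU _ prDU.
  have [||V sylV sUV] := @Sylow_superset p _ 'N_G(D)%G 'N_U(D)%G.
  - by rewrite setSI.
  - by apply: pgroupS pU; apply: subsetIl.
  have sDV : D \subset V.
    by rewrite (subset_trans _ sUV) // subsetI normG proper_sub.
  exists V => //; split=> // W sVW; apply: proper_card.
  apply: proper_sub_trans (nilpotent_proper_norm (pgroup_nil pU) prDU) _.
  by rewrite subsetI subsetIl (subset_trans sUV).
have [S1 sylS1 [sDS1 gtS1]] := sylN S sylS prDS.
have [T1 sylT1 [sDT1 gtT1]] := sylN T sylT prDT.
have p'CD x : x \in 'N_G(D) -> p^'.-elt x -> x \in 'C(D).
  by apply: p'C => //; apply: pgroupS (subsetIl _ _) pS.
have [c Cc eqT1] := Sylow_norm_cent_trans p'CD sylS1 sylT1.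
have Gc : c \in G by case/setIP: Cc.
(* [S2] is the bridge: it meets [S] in more than [D], and [S2 :^ c] meets [T] in more than [D], so
   induction applies to both pairs. *)
have [||S2 sylS2 sS12] := @Sylow_superset p _ G S1.
- by rewrite (subset_trans (pHall_sub sylS1)) ?subsetIl.
- exact: pHall_pgroup sylS1.
have IH (U V : {group gT}) : p.-Sylow(G) U -> p.-Sylow(G) V ->
    D \subset V -> D \subset U ->  #|D| < #|U :&: V| ->
    exists2 a, a \in 'C_G(D) & V :=: U :^ a.
  move=> sylU sylV sDV sDU ltDUV.
  have [|//|//|a Ca ->] := IHn U V; last first.
    by exists a => //; apply: subsetP Ca; rewrite setIS ?centS // subsetI sDU.
  apply: leq_trans (_ : _ < #|G| - #|D|) _; last by rewrite -ltnS.
  rewrite ltn_sub2l //.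
  apply: leq_trans ltDUV _; apply: subset_leq_card.
  by rewrite subIset ?(pHall_sub sylU).
have [|||||a Ca defS2] := IH S S2 => //.
- exact: subset_trans sS12.
- exact: proper_sub.
- exact: gtS1.
have sT12 : T1 \subset (S2 :^ c)%G by rewrite eqT1 conjSg.
have [|||||b Cb defT] := IH (S2 :^ c)%G T => //.
- by rewrite pHallJ.
- exact: proper_sub.
- exact: subset_trans sT12.
- by rewrite setIC gtT1.
exists (a * c * b); first exact: groupM (groupM Ca Cc) Cb.
by rewrite !conjsgM -defS2 defT.
Qed.

(** Both [P :^ g] and [P] contain [x ^ g], so some [c] centralising [x ^ g] takes the first to the
    second, and [g * c] normalises [P]. Its [p']-part centralises [P], so its [p]-part, which lies
    in [P], already sends [x] to [x ^ g]. *)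
Lemma Sylow_controls_fusion p G P :
    (forall X x, X \subset G -> p.-group X -> x \in 'N_G(X) -> p^'.-elt x ->
       x \in 'C(X)) ->
    p.-Sylow(G) P ->
  forall x g, x \in P -> g \in G -> x ^ g \in P ->
    exists2 u, u \in P & x ^ g = x ^ u.
Proof.
move=> p'C sylP x g Px Gg Pxg; have [sPG pP _] := and3P sylP.
have sylPg : p.-Sylow(G) (P :^ g)%G by rewrite pHallJ.
have [c /setIP[Gc Cc] defP] := Sylow_setI_cent_trans p'C sylPg sylP.
have Ngc : g * c \in 'N_G(P).
  by rewrite inE groupM //=; apply/normP; rewrite conjsgM -defP.
have xgc : x ^ (g * c) = x ^ g.
  rewrite conjgM; apply/conjg_fixP/commgP; apply: commute_sym.
  by apply: (centP Cc); rewrite inE memJ_conjg Px.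
have sylPN : p.-Sylow('N_G(P)) P.
  by apply: pHall_subl sylP; rewrite ?subsetIl // subsetI sPG normG.
have p'CP y : y \in 'N_G(P) -> p^'.-elt y -> y \in 'C(P) by apply: p'C.
set n := g * c in Ngc xgc; exists n.`_p.
  rewrite (mem_normal_Hall sylPN) ?p_elt_constt ?groupX //.
  by rewrite normal_subnorm.
rewrite -xgc -{1}(consttC p n) -(commuteX2 _ _ (commute_refl n)) conjgM.
congr (_ ^ _); apply/conjg_fixP/commgP/commute_sym.
by apply: (centP (p'CP _ _ (p_elt_constt _ _))); rewrite ?groupX.
Qed.

(** For the least prime divisor [p] of [#|G|], every [p']-element is a product of [q]-elements with
    [q > p], so the fusion lemmas make the derived subgroup proper; it inherits the hypothesis. *)
Lemma solvable_trivial_coprime_action G :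
    (forall p q X x, prime p -> prime q -> p < q -> X \subset G ->
       p.-group X -> x \in 'N_G(X) -> q.-elt x -> x \in 'C(X)) ->
  solvable G.
Proof.
have [n] := ubnP #|G|; elim: n G => // n IHn G leGn trG.
have [-> | ntG] := eqVneq (G : {set gT}) 1; first exact: solvable1.
pose p := pdiv #|G|; have p_pr : prime p by rewrite pdiv_prime ?cardG_gt1.
have [P sylP] := Sylow_exists p G.
have ntP : P :!=: 1.
  by rewrite -cardG_gt1 (card_Hall sylP) p_part_gt1 mem_primes p_pr cardG_gt0 pdiv_dvd.
have p'C X x : X \subset G -> p.-group X -> x \in 'N_G(X) -> p^'.-elt x ->
    x \in 'C(X).
  move=> sXG pX Nx p'x; rewrite -(prod_constt x); apply: group_prod => q _.
  have [-> | ntxq] := eqVneq x.`_q 1; first exact: group1.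
  have : q \in \pi(#[x]) by rewrite -p_part_gt1 -order_constt order_gt1.
  rewrite mem_primes => /and3P[q_pr _ qx].
  apply: (trG p q) => //; rewrite ?groupX ?p_elt_constt //.
  have Gx : x \in G by case/setIP: Nx.
  rewrite ltn_neqAle pdiv_min_dvd ?prime_gt1 ?(dvdn_trans qx) ?order_dvdG //.
  by rewrite andbT eq_sym -[_ != _]/(q \in p^') (pnatPpi p'x) // mem_primes q_pr order_gt0.
have prG' := Sylow_fusion_der1_proper sylP ntP (Sylow_controls_fusion p'C sylP).
rewrite (series_sol (der_normal 1 G)) (abelian_sol (der_abelian 0 G)) andbT.
apply: IHn => [|a b X x a_pr b_pr ltab sXG' aX /setIP[G'x Nx]].
  by rewrite -ltnS (leq_trans _ leGn) // ltnS proper_card.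
have sG'G := subsetP (proper_sub prG').
by apply: (trG a b) => //; rewrite ?(subset_trans sXG') ?der_sub // inE sG'G.
Qed.
End Fusion.

(** * Extracting an irreducible coprime action *)

Section Irreducible.
Local Open Scope group_scope.
Implicit Types (gT : finGroupType) (p q : nat).

(** In use, [P / N] is an elementary abelian [p]-group, and these are the preimages of its
    hyperplanes. *)
Definition coatoms gT p (N P : {set gT}) : {set {group gT}} :=
  [set M : {group gT} | [&& N \subset M, M \subset P & #|P : M| == p]].

(** The number of fixed points is congruent to [#|Y|] modulo [q], and both are below [q]. *)
Lemma pgroup_cent_small gT q (B Y : {group gT}) :
  q.-group B -> B \subset 'N(Y) -> #|Y| < q -> B \subset 'C(Y).
Proof.
move=> qB nYB ltYq.
have actB : [acts B, on Y | 'J] by rewrite astabsJ.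
have := pgroup_fix_mod qB actB; rewrite afixJ !modn_small //; last first.
  by apply: leq_ltn_trans ltYq; rewrite subset_leq_card ?subsetIl.
move=> eqC; rewrite centsC; apply/setIidPl/eqP.
by rewrite eqEcard subsetIl eqC leqnn.
Qed.

(** [x] acts trivially on [P / N], whose order [p] is less than [q]. By coprimality its centraliser
    in [P] covers [P / N]; it also contains [N], so it is all of [P]. *)
Lemma coprime_cent_normal_index gT p q (P N : {group gT}) x :
    p.-group P -> q.-elt x -> p < q -> N <| P -> #|P : N| = p ->
    x \in 'N(P) -> x \in 'N(N) -> x \in 'C(N) ->
  x \in 'C(P).
Proof.
move=> pP qx ltpq nsNP iPN nPx nNx cNx.
have [sNP nNP] := andP nsNP.
rewrite -!cycle_subG in nPx nNx cNx *.
have qB : q.-group <[x]> by [].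
have coN : coprime #|N| #|<[x]>|.
  apply: pnat_coprime (pgroupS sNP pP) _; apply: sub_in_pnat qB => r _.
  by rewrite !inE => /eqP->; rewrite neq_ltn ltpq orbT.
have cQ : <[x]> / N \subset 'C(P / N).
  apply: (@pgroup_cent_small _ q _ (P / N)%G); rewrite ?quotient_pgroup ?quotient_norms //.
  by rewrite card_quotient ?iPN.
have := coprime_norm_quotient_cent nPx nNx coN (pgroup_sol (pgroupS sNP pP)).
have /setIidPl -> : P / N \subset 'C(<[x]> / N) by rewrite centsC.
move=> eqQ; rewrite centsC.
have : P \subset 'C_P(<[x]>) * N.
  by rewrite normC ?subIset ?nNP // -quotientSK // eqQ.
have sNC : N \subset 'C_P(<[x]>) by rewrite subsetI sNP centsC.
by rewrite mulGSid // subsetI => /andP[].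
Qed.

(** By minimality of [P], the element [x] centralises [N]. An [L]-invariant [M] of index [p] is
    normalised by [P] and [x], so it equals [N] by maximality; then [x] would centralise [P]. *)
Lemma nonsolvable_irreducible_action gT (G : {group gT}) :
    ~~ solvable G ->
  exists p, exists P N L : {group gT},
    [/\ [/\ prime p, P \subset G, L \subset G & 2 < #|L|],
        [/\ L \subset 'N(P), L :&: P = N, N \proper P & N <| P],
        P^`(1) \subset N, {in P, forall c, c ^+ p \in N} &
        {in coatoms p N P, forall M : {group gT}, ~~ (L \subset 'N(M))}].
Proof.
move=> nsolG.
have [p [q [X [x [p_pr q_pr ltpq [sXG pX Nx qx] cx]]]]] :
    exists p q (X : {group gT}) x, [/\ prime p, prime q, p < q,
      [/\ X \subset G, p.-group X, x \in 'N_G(X) & q.-elt x] & x \notin 'C(X)].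
  apply: contrapT => noact; case/negP: nsolG.
  apply: solvable_trivial_coprime_action => p q X x p_pr q_pr ltpq sXG pX Nx qx.
  by apply: contraT => cx; case: noact; exists p, q, X, x.
pose good (X : {group gT}) :=
  [&& X \subset G, p.-group X, x \in 'N(X) & x \notin 'C(X)].
have [Gx nXx] := setIP Nx.
have goodX : good X by apply/and4P.
case: (arg_minnP (fun Y : {group gT} => #|Y|) goodX) => P /and4P[sPG pP nPx cPx] minP.
have ntP : 1%G \proper P.
  rewrite proper1G; apply: contraNneq cPx => ->; by rewrite -cycle_subG cents1.
pose H := (P <*> <[x]>)%G.
have [N maxN _] : {N : {group gT} | maxnormal N P H & 1%G \subset N}.
  by apply: maxgroup_exists; rewrite ntP norms1.
have /andP[prNP nNH] := maxgroupp maxN; have sNP := proper_sub prNP.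
have nPH : H \subset 'N(P) by rewrite join_subG normG cycle_subG.
have [sPH sxH] : P \subset H /\ <[x]> \subset H by rewrite joing_subl joing_subr.
have nNP := subset_trans sPH nNH.
have nNx : x \in 'N(N) by rewrite -cycle_subG (subset_trans sxH).
have cNx : x \in 'C(N).
  apply: contraLR prNP => cNx; rewrite properEcard sNP -leqNgt.
  apply: minP; apply/and4P; split=> //; first exact: subset_trans sPG.
  exact: pgroupS pP.
have minQ := maxnormal_minnormal nNP nPH maxN.
have pQ : p.-group (P / N) by apply: quotient_pgroup.
have [_ _] := minnormal_solvable minQ (subxx _) (pgroup_sol pQ).
rewrite (is_abelem_pgroup pQ) => /(abelemP p_pr)[abQ expQ].
have coPx : coprime #|P| #|<[x]>|.
  apply: pnat_coprime pP _; apply: sub_in_pnat qx => r _.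
  by rewrite !inE => /eqP->; rewrite neq_ltn ltpq orbT.
exists p, P, N, (N <*> <[x]>)%G; split.
- split; rewrite // ?join_subG ?cycle_subG ?Gx ?(subset_trans sNP) //.
  (* [q] divides the order of [x] and exceeds [p], so it is at least 3; this is the source of the 3
     in the final bound. *)
  have qx1 : q %| #[x].
    have [|//] := @pgroup_pdiv _ q <[x]>%G qx.
    by rewrite cycle_eq1; apply: contraNneq cPx => ->; apply: group1.
  apply: leq_trans (_ : #|<[x]>| <= _); last by rewrite subset_leq_card ?joing_subr.
  apply: leq_trans (dvdn_leq (cardG_gt0 _) qx1).
  by apply: leq_ltn_trans ltpq; apply: prime_gt1.
- split=> //; last by apply/andP.
    by rewrite join_subG (subset_trans sNP (normG P)) cycle_subG.
  rewrite /= norm_joinEr ?cycle_subG // -group_modl // setIC.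
  by rewrite (coprime_TIg coPx) mulg1.
- by rewrite der1_min.
- move=> c Pc; have nNc := subsetP nNP c Pc.
  apply: coset_idr; first by rewrite groupX.
  by rewrite morphX // expQ // mem_quotient.
- move=> M; rewrite inE => /and3P[sNM sMP /eqP iPM]; apply/negP.
  rewrite join_subG cycle_subG => /andP[_ nMx].
  have nMP : P \subset 'N(M).
    by apply: sub_der1_norm sMP; apply: subset_trans sNM; apply: der1_min.
  have prMP : M \proper P.
    by rewrite properEneq sMP andbT; apply: contraTneq (prime_gt1 p_pr) => eqM;
       rewrite -iPM eqM indexgg.
  have eqMN : M = N.
    case/maxgroupP: maxN => _ /(_ M) maxN; apply/val_inj/maxN => //.
    by rewrite prMP join_subG nMP cycle_subG.
  case/negP: cPx; apply: (@coprime_cent_normal_index _ p q P N) => //.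
    by apply/andP.
  by rewrite -eqMN.
Qed.
End Irreducible.

(** * Sums over cosets of hyperplanes *)

Section Sums.
Local Open Scope group_scope.
Variable V : zmodType.

Lemma sum_constant_fibers (I J : finType) (A : {set I}) (h : I -> J) n (f : J -> V) :
    {in A, forall a, #|[set b in A | h b == h a]| = n} ->
  (\sum_(a in A) f (h a) = (\sum_(y in h @: A) f y) *+ n)%R.
Proof.
move=> fib; rewrite (partition_big h (mem (h @: A))) /=; last first.
  by move=> a Aa; apply: imset_f.
rewrite -sumrMnl; apply: eq_bigr => _ /imsetP[a Aa ->].
rewrite -(fib a Aa) -sumr_const; apply: eq_big => [b | b /andP[_ /eqP-> //]].
by rewrite inE.
Qed.

Variable gT : finGroupType.
Implicit Types A B : {group gT}.

Lemma sum_mulg A B (f : gT -> V) :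
  (\sum_(a in A) \sum_(b in B) f (a * b)%g =
     (\sum_(u in (A * B)%g) f u) *+ #|A :&: B|)%R.
Proof.
have -> : A * B = (fun z => z.1 * z.2) @: setX A B.
  apply/setP=> u; apply/mulsgP/imsetP => [[a b Aa Bb ->] | [[a b]]].
    by exists (a, b); rewrite ?inE ?Aa.
  by rewrite inE => /andP[Aa Bb] ->; exists a b.
rewrite -(sum_constant_fibers _ (n := #|A :&: B|)).
  by rewrite pair_big; apply: eq_bigl => z; rewrite inE.
case=> a b; rewrite inE /= => /andP[Aa Bb].
(* The fibre of multiplication through [(a, b)] consists of these pairs for [z] in [A :&: B]. *)
rewrite -(card_imset _ (f := fun z => (a * z^-1, z * b))); last first.
  by move=> y z [/mulgI/invg_inj].
apply: eq_card => -[c d]; rewrite !inE /=; apply/andP/imsetP.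
  case=> /andP[Ac Bd] /eqP eq_cd; exists (c^-1 * a).
    rewrite inE groupM ?groupV //= (_ : _ * _ = d * b^-1) ?groupM ?groupV //.
    by apply: (mulIg b); rewrite mulgKV -mulgA -eq_cd mulKg.
  by rewrite invMg invgK mulKVg -mulgA -eq_cd mulKg.
case=> z /setIP[Az Bz] [-> ->]; rewrite !groupM ?groupV //.
by rewrite mulgA mulgKV.
Qed.

Lemma sum_mulgr A u (f : gT -> V) :
  u \in A -> (\sum_(a in A) f (a * u)%g = \sum_(a in A) f a)%R.
Proof.
move=> Au; rewrite [RHS](reindex_inj (mulIg u)) /=.
by apply: eq_bigl => a; rewrite groupMr.
Qed.
End Sums.

(** * Hyperplane sums in an elementary abelian quotient *)

Section Coatoms.
Local Open Scope group_scope.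
Variables (gT : finGroupType) (p : nat) (N P : {group gT}).
Hypotheses (p_pr : prime p) (sNP : N \subset P).
Hypotheses (sP'N : P^`(1) \subset N) (expN : {in P, forall c, c ^+ p \in N}).
Implicit Types (U M : {group gT}).

Let nPU U : N \subset U -> U \subset P -> U <| P.
Proof.
by move=> sNU sUP; rewrite /normal sUP (sub_der1_norm _ sUP) ?(subset_trans sP'N).
Qed.

Lemma coatom_mul M1 M2 :
  M1 \in coatoms p N P -> M2 \in coatoms p N P -> M1 != M2 -> M1 * M2 = P.
Proof.
rewrite !inE => /and3P[sNM1 sM1 iM1] /and3P[_ sM2 iM2] neM.
apply: mulg_normal_maximal => //; first exact: nPU.
  by rewrite p_index_maximal // (eqP iM1).
apply: contra neM => sM21; rewrite eq_sym; apply/eqP/val_inj/eqP => /=.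
rewrite eqEcard sM21 /= -(leq_pmul2r (prime_gt0 p_pr)).
by rewrite -{1}(eqP iM1) -(eqP iM2) !Lagrange.
Qed.

Let index_join U c : N \subset U -> U \subset P -> c \in P :\: U ->
  #|U <*> <[c]> : U| = p.
Proof.
move=> sNU sUP /setDP[Pc Uc]; have [_ nUP] := andP (nPU sNU sUP).
have nUc : c \in 'N(U) := subsetP nUP c Pc.
rewrite -card_quotient ?join_subG ?normG ?cycle_subG //=.
rewrite joingC quotientYidr ?cycle_subG // quotient_cycle //.
apply/(prime_nt_dvdP p_pr).
  by rewrite order_eq1; apply: contra Uc => /eqP/coset_idr->.
by rewrite order_dvdn -morphX //; apply/eqP/coset_id/(subsetP sNU)/expN.
Qed.

Variable R : numFieldType.
Variable f : gT -> R.
Hypothesis f_coatom :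
  forall M u, M \in coatoms p N P -> u \in P -> (\sum_(m in M) f (m * u)%g = 0)%R.
Hypothesis f_top : (\sum_(m in P) f m = 0)%R.

(* Downward induction on U: the overgroups T of index p of U partition P \ U,
   so the vanishing of the sums over the cosets of P and of each T leaves
   (number of T's - 1) times the sum over U u, and U has at least two such T. *)
Lemma coset_sum_eq0 U u :
  N \subset U -> U \subset P -> u \in P -> (\sum_(t in U) f (t * u)%g = 0)%R.
Proof.
have [k] := ubnP (#|P| - #|U|); elim: k U u => // k IHk U u leUk sNU sUP Pu.
have sumP : (\sum_(t in P) f (t * u)%g = 0)%R by rewrite sum_mulgr.
have [eqUP | neUP] := eqVneq (U : {set gT}) P; first by rewrite eqUP.
have [Uco | nUco] := boolP (U \in coatoms p N P); first exact: f_coatom.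
(* Any element of [T c] outside [U] generates [T c] over [U], so the sets [X :\: U], for [X] in
   [TT], partition [P :\: U]. *)
pose T c := (U <*> <[c]>)%G; pose TT := [set T c | c in P :\: U].
have sTP c : c \in P -> T c \subset P by move=> Pc; rewrite join_subG sUP cycle_subG.
have cT c : c \in T c by rewrite -cycle_subG joing_subr.
have sUT c : U \subset T c by rewrite joing_subl.
have cardT c : c \in P :\: U -> #|T c| = (#|U| * p)%N.
  by move=> PUc; rewrite -(index_join sNU sUP PUc) (Lagrange (sUT c)).
have T_inj c d : c \in P :\: U -> d \in T c :\: U -> T d = T c.
  move=> PUc /setDP[Tcd Ud]; have /setDP[Pc Uc] := PUc.
  have PUd : d \in P :\: U by rewrite inE Ud (subsetP (sTP c Pc)).
  apply/val_inj/eqP; rewrite eqEcard !cardT // leqnn andbT.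
  by rewrite join_subG sUT cycle_subG.
have prTP c : c \in P :\: U -> (T c : {set gT}) != P.
  move=> PUc; apply: contraNneq nUco => eqTP.
  by rewrite inE sNU sUP -eqTP /=; apply/eqP/index_join.
have sumT X : X \in TT -> (\sum_(t in X) f (t * u)%g = 0)%R.
  case/imsetP=> c PUc ->; have /setDP[Pc Uc] := PUc; apply: IHk => //.
  - apply: leq_trans (_ : _ < #|P| - #|U|) _; last by rewrite -ltnS.
    have prUT : U \proper T c.
      by rewrite properE sUT; apply: contra Uc => /subsetP->.
    apply: ltn_sub2l (proper_card prUT).
    by rewrite proper_card // properEneq neUP.
  - exact: subset_trans (sUT c).
  - exact: sTP.
have sumTU X : X \in TT ->
    (\sum_(t in X :\: U) f (t * u)%g = - \sum_(t in U) f (t * u)%g)%R.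
  move=> TTX; have := sumT X TTX; rewrite (big_setID (gval U)) /=.
  have /setIidPr -> : U \subset X by case/imsetP: TTX => c _ ->.
  by move=> s0; apply/eqP; rewrite -addr_eq0 addrC s0.
have sumPU :
    (\sum_(c in P :\: U) f (c * u)%g = - \sum_(t in U) f (t * u)%g)%R.
  have := sumP; rewrite (big_setID (gval U)) /= (setIidPr sUP) => s0.
  by apply/eqP; rewrite -addr_eq0 addrC s0.
have : (\sum_(c in P :\: U) f (c * u)%g =
        - (\sum_(t in U) f (t * u)%g) *+ #|TT|)%R.
  rewrite (partition_big T (mem TT)) /=; last by move=> c PUc; apply: imset_f.
  rewrite -sumr_const; apply: eq_bigr => X TTX; rewrite -(sumTU X TTX).
  case/imsetP: TTX => c PUc ->; have /setDP[Pc Uc] := PUc.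
  apply: eq_bigl => d; apply/andP/idP => [[/setDP[Pd Ud] /eqP<-] | TUd].
    by rewrite inE Ud cT.
  rewrite (T_inj c d PUc TUd) eqxx; split=> //; have /setDP[Td Ud] := TUd.
  by rewrite inE Ud (subsetP (sTP c Pc)).
rewrite sumPU => /eqP; rewrite -subr_eq0 -{1}[(- _)%R]mulr1n.
(* As [U] is neither [P] nor a coatom, [T c] is proper, and any [d] outside it yields a second
   overgroup. *)
have TT_gt1 : 1 < #|TT|.
  have /properP[_ [c Pc Uc]] : U \proper P by rewrite properEneq neUP.
  have PUc : c \in P :\: U by rewrite inE Uc.
  have /properP[_ [d Pd Td]] : T c \proper P by rewrite properEneq prTP ?sTP.
  apply/card_gt1P; exists (T c), (T d); split; rewrite ?imset_f //.
    by rewrite inE Pd andbT; apply: contra Td; apply: (subsetP (sUT c)).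
  by apply: contraNneq Td => ->.
rewrite -opprB oppr_eq0 -mulrnBr 1?ltnW // mulrn_eq0 subn_eq0 leqNgt TT_gt1 /=.
by rewrite oppr_eq0 => /eqP.
Qed.

(** Injectivity of the Radon transform on [P / N]: at [U = N] the coset sum is [#|N|] copies of
    [f u]. *)
Lemma coatom_sums_determine :
    (forall n u, n \in N -> u \in P -> f (n * u)%g = f u) ->
  {in P, forall u, f u = 0%R}.
Proof.
move=> f_inv u Pu; have := coset_sum_eq0 (subxx N) sNP Pu.
rewrite (eq_bigr (fun=> f u)) => [|n Nn]; last exact: f_inv.
by rewrite sumr_const => /eqP; rewrite mulrn_eq0 eqn0Ngt cardG_gt0 => /eqP.
Qed.
End Coatoms.

(** * G-sets and equivariant kernels *)

Section SubGset.
Local Open Scope group_scope.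
Variables (gT : finGroupType) (G : {group gT}) (T : finType).
Variables (to : {action gT &-> T}) (S : {set T}).
Hypothesis actS : [acts G, on S | to].

Fact acts_sub_dom : G \subset subact_dom (fun x => x \in S) to.
Proof.
rewrite /subact_dom; suff -> : [set x | x \in S] = S by [].
by apply/setP=> x; rewrite inE.
Qed.

Definition sub_gset : gset G :=
  GSet (to^? \ acts_sub_dom : action G {x : T | x \in S}).

Lemma card_sub_gset : #|sub_gset| = #|S|.
Proof. by rewrite /= card_sig; apply: eq_card. Qed.

Lemma val_lact_sub g (x : sub_gset) :
  g \in G -> val (lact g x) = to (val x) g^-1.
Proof.
move=> Gg; rewrite /lact /= val_subact.
by rewrite (subsetP acts_sub_dom) ?groupV.
Qed.
End SubGset.

(** * Linear equivalence from invariant kernels *)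

Section Kernel.
Local Open Scope ring_scope.
Variables (k : fieldType) (I J : finType) (K : I -> J -> k).

Definition kernel_map (f : {ffun I -> k^o}) : {ffun J -> k^o} :=
  [ffun j => \sum_i K i j * f i].

Fact kernel_map_is_linear : linear kernel_map.
Proof.
move=> a f g; apply/ffunP=> j; rewrite !ffunE scaler_sumr -big_split /=.
by apply: eq_bigr => i _; rewrite !ffunE mulrDr; congr (_ + _); rewrite mulrCA.
Qed.

HB.instance Definition _ := GRing.isLinear.Build k {ffun I -> k^o}
  {ffun J -> k^o} *:%R kernel_map kernel_map_is_linear.

Hypothesis K_nondeg :
  forall f : I -> k, (forall j, \sum_i K i j * f i = 0) -> forall i, f i = 0.

Lemma kernel_map_ker0 : lker (linfun kernel_map) == 0%VS.
Proof.
rewrite -subv0; apply/subvP=> f; rewrite memv_ker memv0 lfunE => /eqP f0.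
apply/eqP/ffunP=> i; rewrite ffunE; apply: K_nondeg => j.
by have /ffunP/(_ j) := f0; rewrite !ffunE.
Qed.

Lemma kernel_card_le : (#|I| <= #|J|)%N.
Proof.
have := limg_dim_eq (f := linfun kernel_map) (U := fullv).
rewrite (eqP kernel_map_ker0) capv0 => /(_ erefl) eqd.
have := dimvS (subvf (linfun kernel_map @: fullv)%VS).
by rewrite eqd !dimvf /= /dim /= !muln1.
Qed.

Lemma kernel_map_bij : #|I| = #|J| -> bijective kernel_map.
Proof.
move=> eqIJ; have ker0 := kernel_map_ker0.
have full : limg (linfun kernel_map) = fullv.
  apply/eqP; rewrite eqEdim subvf limg_dim_eq ?(eqP ker0) ?capv0 //.
  by rewrite !dimvf /= /dim /= !muln1 eqIJ.
exists (linfun kernel_map)^-1%VF => f.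
  by rewrite -[kernel_map f]lfunE lker0_lfunK.
by rewrite -[LHS]lfunE limg_lfunVK // full memvf.
Qed.
End Kernel.

Section KernelEquivalence.
Local Open Scope ring_scope.
Variables (k : fieldType) (gT : finGroupType) (G : {group gT}).

(** Injectivity of [K] and of its transpose bounds each cardinality by the other, so the kernel map
    is bijective without an explicit inverse. Invariance of [K] makes it equivariant. *)
Lemma linearly_equivalent_kernel (X Y : gset G) (K : X -> Y -> k) :
    (forall g x y, g \in G -> K (lact g x) (lact g y) = K x y) ->
    (forall f : X -> k, (forall y, \sum_x K x y * f x = 0) -> forall x, f x = 0) ->
    (forall f : Y -> k, (forall x, \sum_y K x y * f y = 0) -> forall y, f y = 0) ->
  #|X| = #|Y| /\ linearly_equivalent k X Y.
Proof.
move=> Kinv Kinj Kinj'.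
have eqXY : #|X| = #|Y|.
  apply/eqP; rewrite eqn_leq (kernel_card_le Kinj).
  exact: (@kernel_card_le _ _ _ (fun y x => K x y)).
split=> //; exists (kernel_map K); split; first exact: kernel_map_bij.
move=> g f Gg; apply/ffunP=> y; rewrite !ffunE.
have lactK : cancel (lact (X := X) g) (lact (g^-1)%g).
  by move=> x; rewrite /lact -actMin ?groupV // invgK mulVg act1.
rewrite (reindex_inj (can_inj lactK)) /=.
apply: eq_bigr => x _; rewrite ffunE lactK -[K x _ in RHS](Kinv g) //; congr (K _ _ * _).
by rewrite /lact -actMin ?groupV // invgK mulgV act1.
Qed.

Lemma linearly_equivalent_sub_gset (T : finType) (to : {action gT &-> T})
    (S S' : {set T}) (actS : [acts G, on S | to]) (actS' : [acts G, on S' | to])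
    (K : T -> T -> k) :
    (forall g x y, K (to x g) (to y g) = K x y) ->
    (forall f : T -> k, {in S', forall y, \sum_(x in S) K x y * f x = 0} ->
       {in S, forall x, f x = 0}) ->
    (forall f : T -> k, {in S, forall x, \sum_(y in S') K x y * f y = 0} ->
       {in S', forall y, f y = 0}) ->
  #|S| = #|S'| /\ linearly_equivalent k (sub_gset actS) (sub_gset actS').
Proof.
move=> Kinv Kinj Kinj'.
have lift (A : {set T}) (f : {x : T | x \in A} -> k) :
    exists f' : T -> k, forall x, f x = f' (val x).
  exists (fun t => if insub t is Some u then f u else 0) => x.
  by rewrite valK.
have [|||eqXY equiv] := @linearly_equivalent_kernel (sub_gset actS) (sub_gset actS')
  (fun x y => K (val x) (val y)).
- by move=> g x y Gg; rewrite !val_lact_sub.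
- move=> f f0 x; have [f' eqf] := lift _ f; rewrite eqf.
  apply: Kinj (valP x) => y S'y; rewrite big_sub.
  by rewrite -[RHS](f0 (Sub y S'y)); apply: eq_bigr => z _; rewrite eqf.
- move=> f f0 y; have [f' eqf] := lift _ f; rewrite eqf.
  apply: Kinj' (valP y) => x Sx; rewrite big_sub.
  by rewrite -[RHS](f0 (Sub x Sx)); apply: eq_bigr => z _; rewrite eqf.
by rewrite -(card_sub_gset actS) -(card_sub_gset actS').
Qed.
End KernelEquivalence.

(** * The Radon transform relation *)

Section Flags.
Local Open Scope group_scope.
Variable gT : finGroupType.
Definition flag : finType := ({set gT} * {set gT})%type.

(* Induced G-sets without quotients: inducing from H is done by moving pairs
   (conjugate of a subgroup of P, right translate of a subset of H) around by all
   of G. The second component determines the coset H g it lives on, and [set0]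
   is a placeholder first component for the points and for the one-point set. *)
Definition flag_act (x : flag) (g : gT) : flag := (x.1 :^ g, x.2 :* g).

Fact flag_act1 : forall x : flag, flag_act x 1 = x.
Proof. by case=> U B; rewrite /flag_act /= conjsg1 mulg1. Qed.
Fact flag_actM : forall x : flag, act_morph flag_act x.
Proof. by case=> U B g h; rewrite /flag_act /= conjsgM rcosetM. Qed.
Definition flag_action := TotalAction flag_act1 flag_actM.

(** A point is incident with the affine hyperplanes through it and with the one-point set of its
    [H]-coset. A direction is incident with the hyperplanes parallel to it, and with no one-point
    set, since there [y.1] is [set0]. *)
Definition incidence (x y : flag) : rat :=
  (if x.1 == set0 then x.2 \subset y.2
   else (x.1 == y.1) && (y.2 \subset x.2))%:R%R.

Lemma incidence_act x y g :
  incidence (flag_action x g) (flag_action y g) = incidence x y.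
Proof.
have inj := inj_eq (@conjsg_inj _ g).
by rewrite /incidence /= -{1}(conj0g g) !inj !rcosetS.
Qed.

Variables (G P N L : {group gT}) (p : nat).
Hypotheses (p_pr : prime p) (sPG : P \subset G) (sLG : L \subset G).
Hypotheses (nPL : L \subset 'N(P)) (defN : L :&: P = N).
Hypotheses (sP'N : P^`(1) \subset N) (expN : {in P, forall c, c ^+ p \in N}).
Implicit Types (M U : {group gT}) (g : gT) (x y : flag).

Local Notation co := (coatoms p N P).
Local Notation H := (L <*> P)%G.

(* [point], [hplane], [dirn], [top] are respectively the points of V, the affine
   hyperplanes, the linear hyperplanes and the one-point H-set, moved by g. *)
Definition point g : flag := (set0, L :* g).
Definition top g : flag := (set0, gval H :* g).
Definition dirn (M : {set gT}) g : flag := (M :^ g, gval H :* g).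
Definition hplane (M : {set gT}) g : flag := (M :^ g, L * M :* g).

Definition points := point @: G.
Definition tops := top @: G.
Definition dirns := [set dirn z.1 z.2 | z : {group gT} * gT in setX co G].
Definition hplanes := [set hplane z.1 z.2 | z : {group gT} * gT in setX co G].

Definition points_dirns := points :|: dirns.
Definition hplanes_tops := hplanes :|: tops.

Let sNP : N \subset P. Proof. by rewrite -defN subsetIr. Qed.
Let sNL : N \subset L. Proof. by rewrite -defN subsetIl. Qed.
Let nNL : L \subset 'N(N).
Proof. by rewrite -defN normsI ?normG. Qed.

Let coP M : M \in co -> [/\ N \subset M, M \subset P & M <| P].
Proof.
rewrite inE => /and3P[sNM sMP _]; split=> //.
by rewrite /normal sMP (sub_der1_norm _ sMP) ?(subset_trans sP'N).
Qed.

Let co_conj M l : M \in co -> l \in L -> (M :^ l)%G \in co.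
Proof.
rewrite !inE /= => /and3P[sNM sMP iM] Ll.
have nPl : P :^ l = P by apply/normP/(subsetP nPL).
have nNl : N :^ l = N by apply/normP/(subsetP nNL).
by rewrite -{1}nNl -{1 2}nPl !conjSg sNM sMP indexJg.
Qed.

Let HE : H = L * P :> {set gT}. Proof. exact: norm_joinEl. Qed.

Let mem_H g b :
  reflect (exists l a, [/\ l \in L, a \in P & b = l * (a * g)]) (b \in H :* g).
Proof.
rewrite HE; apply: (iffP rcosetP) => [[_ /mulsgP[l a Ll Pa ->] ->] | ].
  by exists l, a; rewrite mulgA.
by case=> l [a [Ll Pa ->]]; exists (l * a); rewrite ?mem_mulg // mulgA.
Qed.

Let mem_hplane M g b :
  reflect (exists l m, [/\ l \in L, m \in M & b = l * (m * g)]) (b \in L * M :* g).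
Proof.
apply: (iffP rcosetP) => [[_ /mulsgP[l a Ll Pa ->] ->] | ].
  by exists l, a; rewrite mulgA.
by case=> l [a [Ll Pa ->]]; exists (l * a); rewrite ?mem_mulg // mulgA.
Qed.

Let H_mul h g : h \in H -> gval H :* (h * g) = gval H :* g.
Proof. by move=> Hh; rewrite rcosetM rcoset_id. Qed.

Let HP a : a \in P -> a \in H. Proof. exact: subsetP (joing_subr _ _) _. Qed.
Let HL a : a \in L -> a \in H. Proof. exact: subsetP (joing_subl _ _) _. Qed.

Let coJ M a : M \in co -> a \in P -> M :^ a = M.
Proof. by move=> /coP[_ _ /andP[_ nMP]] Pa; apply/normP/(subsetP nMP). Qed.

Lemma point_mul l g : l \in L -> point (l * g) = point g.
Proof. by move=> Ll; rewrite /point rcosetM [L :* l]rcoset_id. Qed.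

Lemma top_mul h g : h \in H -> top (h * g) = top g.
Proof. by move=> Hh; rewrite /top H_mul. Qed.

Lemma dirn_mul M a g : M \in co -> a \in P -> dirn M (a * g) = dirn M g.
Proof. by move=> Mco Pa; rewrite /dirn H_mul ?HP // conjsgM coJ. Qed.

Lemma hplane_mulr M m g : m \in M -> hplane M (m * g) = hplane M g.
Proof.
by move=> Mm; rewrite /hplane conjsgM conjGid // rcosetM -[_ :* m]mulgA rcoset_id.
Qed.

(** [L] fixes the origin of [V] and acts linearly: since [L] absorbs [l^-1], the set [L * M :* l] is
    [L * M :^ l]. *)
Lemma hplane_mull M l g : l \in L -> hplane M (l * g) = hplane (M :^ l) g.
Proof.
move=> Ll; rewrite /hplane conjsgM rcosetM; congr (_, _ :* _).
by rewrite conjsgE [RHS]mulgA [L :* l^-1]rcoset_id ?groupV // mulgA.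
Qed.

Let LU_refl U g : g \in L * U :* g.
Proof. by apply/mem_hplane; exists 1, 1; rewrite !mul1g. Qed.

Let LU_mulP U : N \subset U -> U \subset P -> L * U :&: P = U.
Proof. by move=> sNU sUP; rewrite setIC -group_modr // setIC defN mulSGid. Qed.

Let hplane_inj M a b g : N \subset M -> M \subset P -> a \in P -> b \in P ->
  L * M :* (b * g) = L * M :* (a * g) -> b * a^-1 \in M.
Proof.
move=> sNM sMP Pa Pb; rewrite !rcosetM => /rcoset_inj eqLM.
rewrite -(LU_mulP sNM sMP) inE groupM ?groupV // andbT -mem_rcoset -eqLM.
exact: LU_refl.
Qed.

Let sub_coset (U : {set gT}) b g :
  (L :* b \subset L * U :* g) = (b \in L * U :* g).
Proof.
apply/idP/idP => [/subsetP-> // | Lb]; first exact: rcoset_refl.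
have -> : L * U :* g = L * (L * U :* g) by rewrite !mulgA mulGid.
by rewrite mulgS // sub1set.
Qed.

Lemma acts_points_dirns : [acts G, on points_dirns | flag_action].
Proof.
apply/subsetP=> h Gh; rewrite !inE; apply/subsetP=> y; rewrite !inE.
case/orP=> /imsetP[].
  move=> g Gg ->; apply/orP; left; apply/imsetP; exists (g * h); rewrite ?groupM //.
  by rewrite /point /= /flag_act conj0g rcosetM.
case=> M g; rewrite inE /= => /andP[Mco Gg] ->; apply/orP; right.
apply/imsetP; exists (M, g * h); first by rewrite inE Mco groupM.
by rewrite /dirn /= /flag_act conjsgM rcosetM.
Qed.

Lemma acts_hplanes_tops : [acts G, on hplanes_tops | flag_action].
Proof.
apply/subsetP=> h Gh; rewrite !inE; apply/subsetP=> y; rewrite !inE.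
case/orP=> /imsetP[].
  case=> M g; rewrite inE /= => /andP[Mco Gg] ->; apply/orP; left.
  apply/imsetP; exists (M, g * h); first by rewrite inE Mco groupM.
  by rewrite /hplane /= /flag_act conjsgM rcosetM.
move=> g Gg ->; apply/orP; right; apply/imsetP; exists (g * h); rewrite ?groupM //.
by rewrite /top /= /flag_act conj0g rcosetM.
Qed.

Let conj_nt0 M g : (M :^ g == set0) = false.
Proof. by apply/negbTE/set0Pn; exists 1; rewrite group1. Qed.

Let big_points_dirns (F : flag -> rat) :
  (\sum_(x in points_dirns) F x = \sum_(x in points) F x + \sum_(x in dirns) F x)%R.
Proof.
rewrite -bigU; first by apply: eq_bigl => x; rewrite !inE.
rewrite disjoint_subset; apply/subsetP => _ /imsetP[g _ ->].
rewrite !inE; apply/imsetP => -[[M h]] _ /= [] /esym/eqP.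
by rewrite conj_nt0.
Qed.

Let big_hplanes_tops (F : flag -> rat) :
  (\sum_(x in hplanes_tops) F x = \sum_(x in hplanes) F x + \sum_(x in tops) F x)%R.
Proof.
rewrite -bigU; first by apply: eq_bigl => x; rewrite !inE.
rewrite disjoint_subset; apply/subsetP => _ /imsetP[[M g] _ ->].
rewrite !inE; apply/imsetP => -[h] _ /= [] /eqP.
by rewrite conj_nt0.
Qed.

(** The points inside [L * U :* g] are the cosets [L :* (m * g)] with [m] in [U], each arising from
    [#|N|] values of [m] because [L :&: U = N]. The proof compares [#|L|] times both sides with a
    sum over [L * U]. *)
Lemma sum_points (f : flag -> rat) U g :
    N \subset U -> U \subset P -> g \in G ->
  ((\sum_(x in points | x.2 \subset (L * U :* g)%g) f x) *+ #|N| =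
     \sum_(m in U) f (point (m * g)%g))%R.
Proof.
move=> sNU sUP Gg; apply: (pmulrnI (cardG_gt0 L)).
have defLU : L :&: U = N.
  by apply/eqP; rewrite eqEsubset subsetI sNL sNU -defN setIS.
have := sum_mulg L U (fun u => f (point (u * g)%g)).
rewrite defLU exchange_big /= (eq_bigr (fun m => f (point (m * g)) *+ #|L|)%R); last first.
  move=> m _; rewrite -sumr_const; apply: eq_bigr => l Ll.
  by rewrite -mulgA point_mul.
rewrite sumrMnl => ->; rewrite -mulrnA mulnC mulrnA; congr (_ *+ _)%R.
rewrite (@sum_constant_fibers _ _ _ _ (fun u => point (u * g)) #|L|).
  congr (_ *+ _)%R; apply: eq_bigl => x; apply/andP/imsetP.
    case=> /imsetP[b Gb ->] /=; rewrite sub_coset => /rcosetP[u LUu ->].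
    by exists u.
  case=> u LUu ->; rewrite /= sub_coset mem_rcoset mulgK; split=> //.
  apply: imset_f; rewrite groupM //.
  by apply: subsetP LUu; rewrite mul_subG // (subset_trans sUP).
move=> u LUu; rewrite -(card_rcoset L u); apply: eq_card => v.
rewrite !inE /point; apply/andP/idP=> [[_ /eqP[eqv]] | Lv].
  by move: eqv; rewrite !rcosetM => /rcoset_inj <-; apply: rcoset_refl.
split; last by rewrite !rcosetM -(rcoset_eqP Lv).
case/mulsgP: LUu Lv => l m Ll Um -> /rcosetP[l' Ll' ->].
by rewrite mulgA mem_mulg ?groupM.
Qed.

(** Adding the hyperplane equations over a parallel class leaves a multiple of the total over the
    points, which is 0 by the equation of [top], plus a multiple of the value at the direction. So
    [f] vanishes on directions, all hyperplane sums vanish, and [coatom_sums_determine] applies. *)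
Lemma incidence_nondeg_l (f : flag -> rat) :
    {in hplanes_tops, forall y, \sum_(x in points_dirns) incidence x y * f x = 0}%R ->
  {in points_dirns, forall x, f x = 0%R}.
Proof.
move=> f0; pose s U g := (\sum_(m in gval U) f (point (m * g)%g))%R.
have Y_hplane M g : M \in co -> g \in G -> hplane M g \in hplanes_tops.
  move=> Mco Gg; rewrite inE; apply/orP; left.
  by apply/imsetP; exists (M, g); rewrite // inE Mco.
have Y_top g : g \in G -> top g \in hplanes_tops.
  by move=> Gg; rewrite inE imset_f ?orbT.
have sum_pt U g (y : flag) : N \subset U -> U \subset P -> g \in G ->
   y.2 = L * U :* g ->
  ((\sum_(x in points) incidence x y * f x) *+ #|N| = s U g)%R.
  move=> sNU sUP Gg y2; rewrite /s -sum_points // -y2; congr (_ *+ _)%R.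
  rewrite big_mkcondr; apply: eq_bigr => _ /imsetP[b _ ->].
  by rewrite /incidence eqxx; case: ifP; rewrite ?mul1r ?mul0r.
have sP0 g : g \in G -> s P g = 0%R.
  move=> Gg; have top2 : (top g).2 = L * P :* g by rewrite /= HE.
  rewrite -(sum_pt P g (top g) sNP (subxx _) Gg top2).
  have := f0 _ (Y_top g Gg); rewrite big_points_dirns [X in (_ + X)%R]big1 ?addr0.
    by move->; rewrite mul0rn.
  case=> _ _ /imsetP[[M h] _ [-> ->]]; rewrite /incidence /=.
  by rewrite conj_nt0 /= mul0r.
have sM0 M g : M \in co -> g \in G ->
    (s M g + f (dirn M g) *+ #|N| = 0)%R.
  move=> Mco Gg; have [sNM sMP _] := coP Mco.
  have := f0 _ (Y_hplane M g Mco Gg).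
  rewrite big_points_dirns [X in (_ + X)%R](bigD1 (dirn M g)) /=; last first.
    by apply/imsetP; exists (M, g); rewrite // inE Mco.
  rewrite [X in (_ + (_ + X))%R]big1 ?addr0.
    move/(congr1 (fun z => z *+ #|N|)%R); rewrite mul0rn mulrnDl (sum_pt M g) //.
    rewrite /incidence /= conj_nt0 eqxx rcosetS HE mulgS ?mul1r //.
  move=> _ /andP[/imsetP[[M' h] _ ->] /= ne]; rewrite /incidence /= conj_nt0.
  case: eqP => [eqM | _]; last by rewrite /= mul0r.
  case: (boolP (_ \subset _)) => [/subsetP/(_ g) | _]; last by rewrite /= mul0r.
  move=> /(_ (LU_refl M g)) gh.
  by rewrite /dirn eqM -(rcoset_eqP gh) eqxx in ne.
have sumM M g : M \in co -> g \in G -> (\sum_(a in P) s M (a * g)%g = 0)%R.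
  move=> Mco Gg; have [_ /subsetP sMP _] := coP Mco.
  rewrite exchange_big big1 //= => m Mm.
  rewrite -[RHS](sP0 g Gg) (reindex_inj (mulgI m^-1)) /=.
  have Pm : m^-1 \in P by rewrite groupV sMP.
  apply: eq_big => [a | a _]; first by rewrite groupMl.
  by rewrite !mulgA mulgV mul1g.
have fM0 M g : M \in co -> g \in G -> f (dirn M g) = 0%R.
  move=> Mco Gg; have := sumM M g Mco Gg.
  rewrite (eq_bigr (fun=> - (f (dirn M g) *+ #|N|))%R) => [|a Pa]; last first.
    rewrite -(dirn_mul g Mco Pa); apply/eqP; rewrite -addr_eq0; apply/eqP/sM0 => //.
    by rewrite groupM // (subsetP sPG).
  rewrite sumr_const -mulNrn -mulrnA => /eqP.
  by rewrite mulrn_eq0 muln_eq0 !eqn0Ngt !cardG_gt0 oppr_eq0 => /eqP.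
move=> x; rewrite inE => /orP[/imsetP[g Gg ->] | /imsetP[[M g]]]; last first.
  by rewrite inE => /andP[Mco Gg] ->; apply: fM0.
rewrite -[g]mul1g.
apply: (coatom_sums_determine (f := fun u => f (point (u * g))) p_pr sNP sP'N expN) => //.
- move=> M u Mco Pu; have Gu := subsetP sPG u Pu.
  have := sM0 M (u * g) Mco (groupM Gu Gg); rewrite fM0 ?groupM // mul0rn addr0 /s.
  by move=> {2}<-; apply: eq_bigr => m _; rewrite mulgA.
- exact: sP0.
- by move=> n u Nn Pu; rewrite -mulgA point_mul // (subsetP sNL).
Qed.

(** Add the point equations over the points of one hyperplane: every other direction contributes a
    multiple of a parallel-class sum, which is 0 by the equation of that direction. So each
    hyperplane value is minus the value at [top], and one more parallel-class sum makes both 0. *)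
Lemma incidence_nondeg_r (f : flag -> rat) :
    {in points_dirns, forall x, \sum_(y in hplanes_tops) incidence x y * f y = 0}%R ->
  {in hplanes_tops, forall y, f y = 0%R}.
Proof.
move=> f0.
have X_point g : g \in G -> point g \in points_dirns.
  by move=> Gg; rewrite inE imset_f.
have X_dirn M g : M \in co -> g \in G -> dirn M g \in points_dirns.
  move=> Mco Gg; rewrite inE; apply/orP; right.
  by apply/imsetP; exists (M, g); rewrite // inE Mco.
have top_sub g g' : g \in H :* g' -> top g' = top g.
  by move=> /rcoset_eqP gg'; rewrite /top gg'.
have sum_point g : g \in G ->
    (\sum_(M in co) f (hplane M g) + f (top g) = 0)%R.
  move=> Gg; have := f0 _ (X_point g Gg).
  rewrite big_hplanes_tops [X in (_ + X)%R](bigD1 (top g)) ?imset_f //=.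
  rewrite [X in (_ + (_ + X))%R]big1 ?addr0.
    rewrite /incidence eqxx /= rcosetS joing_subl mul1r => eq0; rewrite -[RHS]eq0.
    congr (_ + _)%R; rewrite -(big_imset (h := fun M : {group gT} => hplane M g)) /=.
      rewrite [RHS](eq_bigr (fun y => if L :* g \subset y.2 then f y else 0%R)).
        rewrite -big_mkcondr; apply: eq_bigl => y; apply/imsetP/andP.
          case=> M Mco ->; split; last by rewrite sub_coset LU_refl.
          by apply/imsetP; exists (M, g); rewrite // inE Mco.
        case=> /imsetP[[M g']]; rewrite inE /= => /andP[Mco Gg'] -> /=.
        rewrite sub_coset => /mem_hplane[l [m [Ll Mm eqg]]].
        (* Rebasing at [g]: a hyperplane through [point g] is [hplane M' g] for an [L]-conjugate
           [M'] of [M]. *)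
        have -> : g' = m^-1 * (l^-1 * g) by rewrite eqg mulKg mulKg.
        exists (M :^ l^-1)%G; first by rewrite co_conj ?groupV.
        by rewrite hplane_mulr ?groupV // hplane_mull ?groupV.
      by move=> y _; case: ifP; rewrite ?mul1r ?mul0r.
    by move=> M M' _ _ [/conjsg_inj eqM _]; apply: val_inj.
  move=> _ /andP[/imsetP[h Gh ->] /= ne]; rewrite /incidence eqxx /=.
  case: (boolP (_ \subset _)) => [sub | _]; last by rewrite /= mul0r.
  by case/eqP: ne; apply: top_sub; apply: (subsetP sub); apply: rcoset_refl.
have sum_dirn M g : M \in co -> g \in G ->
    (\sum_(a in P) f (hplane M (a * g)%g) = 0)%R.
  move=> Mco Gg; have [sNM sMP _] := coP Mco.
  have := f0 _ (X_dirn M g Mco Gg).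
  rewrite big_hplanes_tops [X in (_ + X)%R]big1 ?addr0; last first.
    by move=> _ /imsetP[h _ ->]; rewrite /incidence /= conj_nt0 /= mul0r.
  rewrite (@sum_constant_fibers _ _ _ _ (fun a => hplane M (a * g)) #|M|).
    move=> eq0; rewrite -[RHS](mul0rn _ #|M|) -[X in (_ = X *+ _)%R]eq0.
    congr (_ *+ _)%R; rewrite [RHS](eq_bigr (fun y =>
        if (M :^ g == y.1) && (y.2 \subset gval H :* g) then f y else 0%R)).
      rewrite -big_mkcondr; apply: eq_bigl => y; apply/imsetP/andP.
        case=> a Pa ->; split.
            apply/imsetP; exists (M, a * g); rewrite // inE Mco.
            by rewrite /= groupM // (subsetP sPG).
          have -> : M :^ g == (hplane M (a * g)).1 by rewrite /= conjsgM (coJ Mco Pa).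
          rewrite -(H_mul g (HP Pa)) HE rcosetS mulgS //.
        case=> /imsetP[[M' g']]; rewrite inE /= => /andP[M'co Gg'] -> /=.
        case/andP=> /eqP eqM /subsetP/(_ _ (LU_refl M' g'))/mem_H.
        case=> l [a [Ll Pa eqg']]; exists a => //.
        have M'l := co_conj M'co Ll.
        rewrite eqg' hplane_mull //; congr hplane.
        by apply: (@conjsg_inj _ g); rewrite eqM eqg' !conjsgM (coJ M'l Pa).
    by move=> y _; rewrite /incidence conj_nt0; case: ifP; rewrite ?mul1r ?mul0r.
  move=> a Pa; rewrite -(card_rcoset M a); apply: eq_card => b.
  rewrite inE; apply/andP/idP => [[Pb /eqP[_ eqA]] | /rcosetP[m Mm ->]].
    by rewrite mem_rcoset (hplane_inj sNM sMP _ _ eqA).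
  have Pm := subsetP sMP m Mm.
  split; first by rewrite groupM.
  by rewrite -mulgA (hplane_mulr _ Mm).
have f_hplane M g : M \in co -> g \in G -> f (hplane M g) = (- f (top g))%R.
  move=> Mco Gg; have [sNM sMP _] := coP Mco.
  have GP a : a \in P -> a * g \in G by move=> Pa; rewrite groupM // (subsetP sPG).
  have : (\sum_(a in M) (\sum_(M' in co) f (hplane M' (a * g)%g) + f (top g)) = 0)%R.
    apply: big1 => a Ma; have Pa := subsetP sMP a Ma.
    by rewrite -(top_mul g (HP Pa)) sum_point ?GP.
  rewrite big_split /= exchange_big /= (bigD1 M) //= [X in (_ + X + _)%R]big1.
    rewrite addr0 (eq_bigr (fun=> f (hplane M g))) => [|a Ma]; last by rewrite hplane_mulr.
    rewrite !sumr_const -mulrnDl => /eqP.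
    by rewrite mulrn_eq0 eqn0Ngt cardG_gt0 addr_eq0 => /eqP.
  move=> M' /andP[M'co neM]; have [sNM' sM'P _] := coP M'co.
  (* The factor [#|M'|] turns the sum over [M] into a sum over pairs from [M'] and [M], whose
     products cover [P] evenly since [M' * M = P]. *)
  apply: (pmulrnI (cardG_gt0 M')); rewrite mul0rn.
  have := sum_mulg M' M (fun a => f (hplane M' (a * g)%g)).
  rewrite (coatom_mul p_pr sP'N M'co Mco neM) sum_dirn // mul0rn => eq0.
  rewrite -[RHS]eq0 exchange_big /= -sumrMnl; apply: eq_bigr => a Ma.
  rewrite (eq_bigr (fun=> f (hplane M' (a * g)))) ?sumr_const // => b M'b.
  by rewrite -mulgA hplane_mulr.
have f_top g : g \in G -> f (top g) = 0%R.
  move=> Gg; have [co0 | [M Mco]] := set_0Vmem co.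
    by have := sum_point g Gg; rewrite co0 big_set0 add0r.
  have GP a : a \in P -> a * g \in G by move=> Pa; rewrite groupM // (subsetP sPG).
  have /eqP := sum_dirn M g Mco Gg.
  rewrite (eq_bigr (fun=> (- f (top g))%R)) => [|a Pa]; last first.
    by rewrite f_hplane ?GP // top_mul ?HP.
  by rewrite sumr_const mulrn_eq0 eqn0Ngt cardG_gt0 oppr_eq0 => /eqP.
move=> y; rewrite inE => /orP[/imsetP[[M g]] | /imsetP[g Gg ->]]; last exact: f_top.
by rewrite inE => /andP[Mco Gg] ->; rewrite f_hplane // f_top // oppr0.
Qed.

Lemma flag_relation :
  #|points_dirns| = #|hplanes_tops| /\
  linearly_equivalent rat (sub_gset acts_points_dirns) (sub_gset acts_hplanes_tops).
Proof.
apply: (@linearly_equivalent_sub_gset _ _ _ _ _ _ _ _ _ incidence).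
- by move=> g x y; apply: incidence_act.
- exact: incidence_nondeg_l.
- exact: incidence_nondeg_r.
Qed.

(** * Non-isomorphism and size of the induced sets *)

Hypothesis prNP : N \proper P.
Hypothesis no_inv : {in co, forall M : {group gT}, ~~ (L \subset 'N(M))}.

(** A fixed point puts a conjugate of [H] inside [L], so [P] lies in [L] and [N = P]. A fixed
    direction [(M :^ g, H :* g)] makes [g] normalise [H]; then [L :^ g] lies in [H] and fixes
    [M :^ g], so [L] normalises [M], against [no_inv]. *)
Lemma points_dirns_not_fixed x : x \in points_dirns -> ~ {in H, forall h, flag_action x h = x}.
Proof.
move=> Xx fixx; move: Xx; rewrite inE => /orP[/imsetP[g Gg xE] | /imsetP[[M g]]].
  case/negP: (proper_subn prNP); rewrite -defN subsetI subxx andbT.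
  have: H :^ g^-1 \subset L.
    apply/subsetP => _ /imsetP[h Hh ->].
    have := fixx h Hh; rewrite xE => -[_ eqLh].
    rewrite conjgE invgK mulgA -mem_rcoset -eqLh.
    by rewrite mem_mulg ?set11 // rcoset_refl.
  move/subset_leq_card; rewrite cardJg => leHL.
  have /eqP -> : gval L == H by rewrite eqEcard joing_subl.
  exact: joing_subr.
rewrite inE /= => /andP[Mco Gg] xE.
have HgH : H :^ g^-1 \subset H.
  apply/subsetP => _ /imsetP[h Hh ->].
  have := fixx h Hh; rewrite xE => -[_ eqHh].
  by rewrite conjgE invgK mulgA -mem_rcoset -eqHh mem_mulg ?set11 // rcoset_refl.
have {}HgH : H :^ g = H.
  have /eqP eqH : H :^ g^-1 == H by rewrite eqEcard HgH cardJg leqnn.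
  by rewrite -{1}eqH conjsgKV.
case/negP: (no_inv Mco); apply/subsetP=> l Ll; apply/normP.
have Hlg : l ^ g \in H by rewrite -HgH memJ_conjg HL.
apply: (@conjsg_inj _ g); rewrite -conjsgM (conjgC l g) conjsgM.
by have := fixx _ Hlg; rewrite xE => -[-> _].
Qed.

Lemma flag_relation_noniso : ~ gset_iso (sub_gset acts_points_dirns) (sub_gset acts_hplanes_tops).
Proof.
case=> phi [[psi phiK psiK] phi_eq].
have Ytop : top 1 \in hplanes_tops by rewrite inE imset_f ?orbT.
pose t : sub_gset acts_hplanes_tops := exist _ (top 1) Ytop.
apply: (@points_dirns_not_fixed (val (psi t)) (valP _)) => h Hh.
have Gh : h^-1 \in G.
  by rewrite groupV; apply: subsetP Hh; rewrite join_subG sLG.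
rewrite -{1}(invgK h) -val_lact_sub //; congr val.
apply: (can_inj phiK); rewrite phi_eq // psiK; apply: val_inj.
rewrite val_lact_sub // invgK /= /flag_act /= conj0g /top.
by rewrite -!rcosetM mul1g -(mulg1 h) H_mul.
Qed.

Lemma card_hplanes : #|dirns| * 2 <= #|hplanes|.
Proof.
(* [r] sends a hyperplane to its direction. Each fibre contains the distinct parallels [hplane M g]
   and [hplane M (a * g)], with [a] in [P] outside [M]. *)
pose r (y : flag) : flag := (y.1, H * y.2).
have rE M g : M \in co -> r (hplane M g) = dirn M g.
  move=> /coP[_ sMP _]; rewrite /r /dirn /= !mulgA !mulGSid ?joing_subl //.
  by rewrite (subset_trans sMP) ?joing_subr.
rewrite -sum1_card -(sum1_card (mem hplanes)) [leqRHS](partition_big r (mem dirns)) /=; last first.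
  move=> _ /imsetP[[M g] /setXP[/= Mco Gg] ->].
  apply/imsetP; exists (M, g); last exact: rE.
  by rewrite inE /= Mco.
rewrite big_distrl /=; apply: leq_sum => _ /imsetP[[M g] /setXP[/= Mco Gg] ->].
have [sNM sMP _] := coP Mco; rewrite mul1n sum1_card; apply/card_gt1P.
have prMP : M \proper P.
  rewrite properEneq sMP andbT; apply: contraTneq Mco => eqM.
  by rewrite inE eqM indexgg (ltn_eqF (prime_gt1 p_pr)) !andbF.
have [_ [a Pa Ma]] := properP prMP.
exists (hplane M g), (hplane M (a * g)); split.
- rewrite unfold_in rE // eqxx andbT; apply/imsetP; exists (M, g) => //.
  by rewrite inE Mco.
- rewrite unfold_in rE // dirn_mul // eqxx andbT; apply/imsetP; exists (M, a * g) => //.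
  by rewrite inE Mco groupM // (subsetP sPG).
- apply: contraNneq Ma => -[_ eqA]; rewrite -(mulg1 a) -invg1.
  by apply: (@hplane_inj M 1 a g) => //; rewrite mul1g.
Qed.

(** Equality of the two sizes gives [2 * #|dirns| <= #|points| + #|dirns|], so there are no more
    directions than points, and the points number [#|G : L|]. *)
Lemma card_points_dirns : #|points_dirns| * #|L| <= 2 * #|G|.
Proof.
have cardpt : (#|points| * #|L|)%N = #|G|.
  rewrite -(Lagrange sLG) mulnC; congr (_ * _)%N.
  have inj : injective (fun A : {set gT} => (set0, A) : flag) by move=> A B [].
  rewrite /indexg -(card_imset _ inj); apply: eq_card => x.
  apply/imsetP/imsetP => [[g Gg ->] | [_ /rcosetsP[g Gg ->] ->]]; last by exists g.
  by exists (L :* g) => //; rewrite -rcosetE imset_f.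
have leX : #|points_dirns| <= #|points| + #|dirns| by rewrite cardsU leq_subr.
have leY : #|hplanes| <= #|hplanes_tops| by rewrite subset_leq_card ?subsetUl.
rewrite -(proj1 flag_relation) in leY.
rewrite -cardpt mulnA leq_mul2r; apply/orP; right.
have := card_hplanes; lia.
Qed.
End Flags.

(** * The bound on [md] and solvability *)

Lemma md_le (k : comPzRingType) (gT : finGroupType) (G : {group gT}) n :
  md_witness k G n -> exists2 m, md k G = (m%:R)%R%:E & m <= n.
Proof.
move=> wn; rewrite /md; case: pselect => [exn | []]; last first.
  by exists n; apply/asboolP.
exists (ex_minn exn) => //; case: ex_minnP => m _; apply.
exact/asboolP.
Qed.

Lemma nonsolvable_md_witness (gT : finGroupType) (G : {group gT}) :
  ~~ solvable G -> exists2 n, md_witness rat G n & 3 * n <= 2 * #|G|.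
Proof.
case/nonsolvable_irreducible_action => p [P [N [L [[p_pr sPG sLG L_gt2]]]]].
case=> nPL defN prNP _ sP'N expN no_inv.
have [eqXY equiv] := flag_relation p_pr sPG sLG nPL defN sP'N expN.
exists #|points_dirns G P N L p|.
  exists (sub_gset (acts_points_dirns G P N L p)), (sub_gset (acts_hplanes_tops G P N L p)).
  split=> //; rewrite ?card_sub_gset //.
  exact: flag_relation_noniso.
have := card_points_dirns p_pr sPG sLG nPL defN sP'N expN; nia.
Qed.

Theorem theorem3p2 (gT : finGroupType) (G : {group gT}) :
  ~~ cyclic G ->
  ((3%:R / 4%:R)%R%:E < md rat G / (#|G|%:R)%R%:E)%E ->
  solvable G.
Proof.
move=> _; apply: contraTT => /nonsolvable_md_witness[n /md_le[m -> le_mn] le_nG].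
have G_gt0 : (0 < #|G|%:R :> rat)%R by rewrite ltr0n cardG_gt0.
(* Since [#|G|] is nonzero, the extended quotient is the rational [m / #|G|], which is at most 2/3,
   hence not above 3/4. *)
rewrite inver gt_eqF // -EFinM lte_fin -leNgt ler_pdivrMr //.
have : (3 * m <= 2 * #|G|)%N by nia.
rewrite -(ler_nat rat) !natrM; lra.
Qed.
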